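(* Let $m=24q+8y+z\ge 33$, where $q$ is a nonnegative integer, $y\in\{0,1,2\}$ and $z\in\{1,3,5,7\}$. Let $\mathcal{A}=(A_0,\dots,A_{m-1})$ be the $(4m+1,m,2,1)$-CEDF over $\mathbb{Z}_{4m+1}$ defined explicitly in the context, and let $$I=\{\,i\in\mathbb{Z}\mid i \text{ even},\ 8q+4y+4\le i\le 16q+4y-4\,\}\setminus\{12q+4y+2\lfloor z/7\rfloor\}.$$ For each $i\in I$, let $\mathcal{A}_i$ be the sequence $i$-associated to $\mathcal{A}$, as defined in the context. Then $\{\mathcal{A}\}\cup\{\mathcal{A}_i\mid i\in I\}$ is a set of $4q-3$ pairwise inequivalent $(4m+1,m,2,1)$-CEDFs over $\mathbb{Z}_{4m+1}$.
   Context: CEDFs. For subsets $A,B$ of an additive group $G$, $\Delta(A,B)$ denotes the multiset $\{a-b\mid a\in A,\ b\in B\}$. Let $G$ be an additive group of order $v$. A sequence $(A_0,\dots,A_{m-1})$ of $m\ge 2$ pairwise disjoint $\ell$-subsets of $G$ is a $(v,m,\ell,\lambda)$-CEDF over $G$ if the multiset union $\bigcup_{i\in\mathbb{Z}_m}\Delta(A_{i+1},A_i)$ (indices modulo $m$) equals $\lambda(G\setminus\{0\})$, i.e. contains each nonzero element exactly $\lambda$ times and does not contain $0$. Equivalence. Two CEDFs $(A_0,\dots,A_{m-1})$ and $(B_0,\dots,B_{m-1})$ over $G$ are equivalent if there are an automorphism $\varphi$ of $G$, an element $g\in G$ and $z\in\mathbb{Z}_m$ such that $\varphi(A_i)+g=B_{i+z}$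 for every $i\in\mathbb{Z}_m$; otherwise they are inequivalent. Notation. For integers $x\equiv y\pmod d$, $d\ge1$, $[x,y]_d=\{x,x+d,x+2d,\dots,y\}$ if $x\le y$ and $[x,y]_d=\varnothing$ if $x>y$. The CEDF $\mathcal{A}$. Write $m=8b+2\epsilon+1$ with $\epsilon\in\{0,1,2,3\}$ (so $b=3q+y$ and $\epsilon=(z-1)/2$). Put $A_i=\{x_i,x_i+d_i\}\subseteq\mathbb{Z}_{4m+1}$ for $0\le i\le m-1$, where $d_i=1$ for even $i\in[0,m-3]_2$, $d_i=2m-2$ for odd $i\in[1,m-4]_2$, $d_{m-2}=3$, $d_{m-1}=2m-2$, and $x_i=2i$ if $i\in[0,m-3]_2$; $x_i=2m-2i+6$ if $i\in[3,4b-1]_4$; $x_i=2m-2i-10$ if $i\in[1,4b-7]_4$; $x_i=2m-8b-4\lceil \epsilon/4\rceil$ if $i=4b-3$; $x_i=4m-2i-10$ if $i\in[4b+1,m-4]_2$; $x_{m-2}=2m-7$; $x_{m-1}=2m-1$; except that when $\epsilon=3$ two of these values are replaced by $x_{4b+1}=m+7$ and $x_{4b+3}=3m-5$. The $i$-associated sequence. For $i\in I$ one has $d_i=1$ and $d_{i-1}=d_{i+1}=2m-2$. Put $z_i=x_{i+1}-x_i-(x_i-x_{i-1})+(d_{i+1}-d_i)\in\mathbb{Z}_{4m+1}$. The sequence $\mathcal{A}_i$ $i$-associated to $\mathcal{A}$ is obtained from $\mathcal{A}$ by replacing $A_i$ with $A_i+z_i$ and leaving all other sets unchanged.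
   Formalization: The count 4q−3 is false when q=1 and z=7 (m=39, 47): the removed element lies outside the range, so I has one element and the set has 2 members, not 1; there the count is stated as 2, and everything else is as in the English. *)

(* Defs.v *)
From mathcomp Require Import all_boot all_order all_algebra.

Set Implicit Arguments.
Unset Strict Implicit.
Unset Printing Implicit Defensive.

Import GRing.Theory.
Local Open Scope ring_scope.

(* Multisets are represented by sequences, compared through [count_mem]. *)
Definition Delta (G : finZmodType) (A B : {set G}) : seq G :=
  [seq a - b | a <- enum A, b <- enum B].

(* Sequences of m subsets are indexed by 'Z_m, so that indices add modulo m.
   'Z_m has m elements only for m >= 2, which [is_CEDF] requires anyway. *)
Definition setseq (G : finZmodType) (m : nat) := {ffun 'Z_m -> {set G}}.

Definition ext_diffs (G : finZmodType) (m : nat) (A : setseq G m) : seq G :=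
  flatten [seq Delta (A (i + 1)) (A i) | i : 'Z_m].

Definition is_CEDF (G : finZmodType) (v m l lambda : nat) (A : setseq G m)
    : Prop :=
  [/\ #|G| = v,
      (2 <= m)%N,
      (forall i : 'Z_m, #|A i| = l),
      (forall i j : 'Z_m, i != j -> [disjoint A i & A j])
    & 0 \notin ext_diffs A /\
      (forall g : G, g != 0 -> count_mem g (ext_diffs A) = lambda)].

Arguments is_CEDF {G} v m l lambda A.

Definition CEDF_equiv (G : finZmodType) (m : nat) (A B : setseq G m) : Prop :=
  exists (phi : {additive G -> G}) (g : G) (z : 'Z_m),
    bijective phi /\
    (forall i : 'Z_m, [set phi a + g | a in A i] = B (i + z)).

(* Membership in [x,y]_d; only used when x = y modulo d. *)
Definition in_ap (x y d : nat) : pred nat :=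
  fun n => (x <= n <= y)%N && (n == x %[mod d])%N.

(* Here m = 8 b + 2 e + 1 with e <= 3, and the subtractions on nat are not
   truncated when b >= 2. *)
Definition d_int (m i : nat) : int :=
  if in_ap 0 (m - 3) 2 i then 1
  else if in_ap 1 (m - 4) 2 i then 2 * m%:Z - 2
  else if i == (m - 2)%N then 3
  else (* i = m - 1 *) 2 * m%:Z - 2.

(* The two values for e = 3 override the general ones. *)
Definition x_int (m b e i : nat) : int :=
  if (e == 3%N) && (i == (4 * b + 1)%N) then m%:Z + 7
  else if (e == 3%N) && (i == (4 * b + 3)%N) then 3 * m%:Z - 5
  else if in_ap 0 (m - 3) 2 i then 2 * i%:Z
  else if in_ap 3 (4 * b - 1) 4 i then 2 * m%:Z - 2 * i%:Z + 6
  else if in_ap 1 (4 * b - 7) 4 i then 2 * m%:Z - 2 * i%:Z - 10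
  else if i == (4 * b - 3)%N then
    2 * m%:Z - 8 * b%:Z - 4 * ((e + 3) %/ 4)%N%:Z (* the ceiling of e / 4 *)
  else if in_ap (4 * b + 1) (m - 4) 2 i then 4 * m%:Z - 2 * i%:Z - 10
  else if i == (m - 2)%N then 2 * m%:Z - 7
  else (* i = m - 1 *) 2 * m%:Z - 1.

Definition d_seq (m : nat) (i : 'Z_m) : 'Z_(4 * m + 1) := (d_int m i)%:~R.

Definition x_seq (m b e : nat) (i : 'Z_m) : 'Z_(4 * m + 1) :=
  (x_int m b e i)%:~R.

Definition A_seq (m b e : nat) : setseq 'Z_(4 * m + 1) m :=
  [ffun i => [set x_seq b e i; x_seq b e i + d_seq i]].

Definition z_shift (m b e : nat) (i : 'Z_m) : 'Z_(4 * m + 1) :=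
  let x := @x_seq m b e in
  let d := @d_seq m in
  x (i + 1) - x i - (x i - x (i - 1)) + (d (i + 1) - d i).

Definition A_assoc (m b e : nat) (i : 'Z_m) : setseq 'Z_(4 * m + 1) m :=
  [ffun j => if j == i then [set a + z_shift b e i | a in A_seq m b e i]
             else A_seq m b e j].

(* All the integers in this range lie between 0 and m - 1 when
   m = 24 q + 8 y + z and q >= 1. The removed integer is in the range except
   when q = 1 and z = 7: then nothing is removed and one index remains, so that
   the set has 4 q - 4 elements in all the other cases but 1 in this one. *)
Definition I_set (m q y z : nat) : {set 'Z_m} :=
  [set i : 'Z_m | [&& ~~ odd i,
                      (8 * q + 4 * y + 4 <= i <= 16 * q + 4 * y - 4)%N
                    & i != 12 * q + 4 * y + 2 * (z %/ 7) :> nat]%N].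

(* Main.v *)
Require Import Defs.
From mathcomp Require Import all_boot all_order all_algebra.
From mathcomp Require Import zify ring.

(** Write v = 4m + 1 and D = 2m - 2, and let A be the explicit sequence, whose
    sets are pairs {x_i, x_i + d_i} with every d_i among 1, D and 3.

    Why A is a CEDF. It has 4m external differences for 4m nonzero residues, so
    it is enough that every nonzero residue is a difference ([CEDF_criterion]).
    If one of d_i, d_(i+1) is 1 and the other is D, then the four differences
    between A_(i+1) and A_i are c - 1, c, c + D - 1, c + D for some c. The m - 3
    steps with i <= m - 4 realize every even c between 8 and 2m
    ([block_cover]), so these steps give all the residues from 7 to 2m and, D
    further, from 2m + 5 to 4m - 2. The last three steps give the twelve
    residues left ([diff_cover]). The sets are disjoint because i can be
    computed from either element of A_i ([owner_point]).

    Why the associated sequences are CEDFs. If d_(i-1) = d_(i+1), the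
    translation by z_i exchanges the differences between A_i and A_(i-1) with
    those between A_(i+1) and A_i, so that the differences of the whole sequence
    are the same ([ext_diffs_swap]). For i in I the translated pair avoids all
    the residues used by A ([shift_free]): the residues r used by A satisfy
    simple conditions on r modulo 4 and on the size of r ([occupied]), and both
    elements of the translated pair violate them.

    Why the sequences are inequivalent. An equivalence multiplies differences
    by a unit u and turns the index by z, so u d_i is d_(i+z) up to sign. The
    value 3 occurs once among the d_i while 1 and D are repeated; hence z = 0,
    and u is 1 or -1. All the sequences have {0, 1} at index 0 and {4, 5} at
    index 2, which leaves only u = 1 and no translation, that is, equality
    ([framed_equiv_eq]). The count then amounts to counting I
    ([card_shiftable]), because a translated pair is never the original one. *)

Set Implicit Arguments.
Unset Strict Implicit.
Unset Printing Implicit Defensive.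
Import Order.TTheory GRing.Theory Num.Theory.
Local Open Scope ring_scope.

(** * Pairs in an abelian group *)

Lemma set2_addP (G : finZmodType) (x d a : G) :
  reflect (exists s : bool, a = x + d *+ s) (a \in [set x; x + d]).
Proof.
apply: (iffP set2P) => [[-> | ->]|[[] ->]].
- by exists false; rewrite addr0.
- by exists true.
- by right.
by left; rewrite addr0.
Qed.

Lemma imset_add_set2 (G : finZmodType) (f : G -> G) (x d g d' : G) :
  f (x + d) = f x + d' ->
  [set f a + g | a in [set x; x + d]] = [set f x + g; f x + g + d'].
Proof. by move=> fd; rewrite imsetU1 imset_set1 fd addrAC. Qed.

Lemma set2_add_inj (G : finZmodType) (x y d d' : G) :
  [set x; x + d] = [set y; y + d'] -> d = d' \/ d = - d'.
Proof.
move=> /setP eq_xy.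
have /set2P : x \in [set y; y + d'] by rewrite -eq_xy !inE eqxx.
have /set2P : x + d \in [set y; y + d'] by rewrite -eq_xy !inE eqxx orbT.
have /set2P : y + d' \in [set x; x + d] by rewrite eq_xy !inE eqxx orbT.
move=> c3 c2 [e1|e1]; last first.
  case: c2 => [c2|/(canRL (addKr x)) c2].
    by right; rewrite -[d](addKr x) c2 e1 opprD addrC addrA subrr sub0r.
  have d0 : d = 0 by rewrite c2 e1 addNr.
  left; move: eq_xy => /(_ y); rewrite d0 addr0 !inE eqxx /= orbb => /eqP yx.
  by apply: (addrI y); rewrite -e1 addr0 yx.
rewrite {}e1 in c2 c3 *; case: c2 => [/(canRL (addKr y)) d0|/addrI]; last by left.
left; rewrite addNr in d0; rewrite d0 in c3 *.
by apply: (addrI y); case: c3 => ->; rewrite addr0.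
Qed.

Lemma eq_up_to_sign (V : zmodType) (x y z : V) :
  z = x \/ z = - x -> z = y \/ z = - y -> x = y \/ x = - y.
Proof.
case=> -> [] => [->|->|<-|/oppr_inj ->]; rewrite ?opprK; by [left | right].
Qed.

(** * External differences *)

Lemma ext_diffsP (G : finZmodType) (m : nat) (A : setseq G m) (g : G) :
  reflect (exists (i : 'Z_m) (a b : G), [/\ a \in A (i + 1), b \in A i & g = a - b])
          (g \in ext_diffs A).
Proof.
apply: (iffP flatten_mapP) => [[i _ /allpairsP[[a b] /= []]]|[i [a [b [ha hb ->]]]]].
  by rewrite !mem_enum => ha hb ->; exists i, a, b.
exists i; first by rewrite mem_enum.
by apply: allpairs_f; rewrite mem_enum.
Qed.

Lemma size_ext_diffs (G : finZmodType) (m l : nat) (A : setseq G m) :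
  (2 <= m)%N -> (forall i, #|A i| = l) -> size (ext_diffs A) = (m * l ^ 2)%N.
Proof.
move=> m_gt1 cardA; rewrite size_flatten /shape -map_comp sumnE big_map.
under eq_bigr do rewrite /= size_allpairs -!cardE !cardA.
by rewrite big_enum /= sum_nat_const card_ord Zp_cast.
Qed.

(** When the group has exactly one more element than there are external
    differences, covering the nonzero elements leaves no room for a repetition
    or for 0. *)
Lemma CEDF_criterion (G : finZmodType) (v m l : nat) (A : setseq G m) :
    (2 <= m)%N -> #|G| = v -> v = (m * l ^ 2).+1 ->
    (forall i, #|A i| = l) ->
    (forall i j, i != j -> [disjoint A i & A j]) ->
    (forall g : G, g != 0 -> g \in ext_diffs A) ->
  is_CEDF v m l 1 A.
Proof.
move=> m_gt1 cardG def_v cardA disjA covA.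
pose s := enum (predC1 (0 : G)).
have uniq_s : uniq s by apply: enum_uniq.
have s_sub : {subset s <= ext_diffs A}.
  by move=> g; rewrite mem_enum => /covA.
have size_s : (size (ext_diffs A) <= size s)%N.
  by rewrite (size_ext_diffs m_gt1 cardA) -cardE cardC1 cardG def_v.
have [_ s_eq] := uniq_min_size uniq_s s_sub size_s.
have uniqA := leq_size_uniq uniq_s s_sub size_s.
split => //; split; first by rewrite -s_eq mem_enum !inE eqxx.
by move=> g g0; rewrite count_uniq_mem // covA.
Qed.

(** * Integers modulo n *)

Lemma intr_addM (n : nat) (a w : int) : (1 < n)%N ->
  (a + w * n%:Z)%:~R = a%:~R :> 'Z_n.
Proof.
move=> n_gt1; rewrite intrD intrM (_ : n%:~R = 0) ?mulr0 ?addr0 //.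
by rewrite -[RHS](pchar_Zp n_gt1).
Qed.

Lemma val_intr (n : nat) (a : int) : (1 < n)%N ->
  (nat_of_ord (a%:~R : 'Z_n))%:Z = (a %% n)%Z.
Proof.
move=> n_gt1; have n0 : n%:Z != 0 by lia.
rewrite {1}(divz_eq a n) addrC intr_addM //.
have n_gt0 : (0 < n%:Z)%R by lia.
have := modz_ge0 a n0; have := ltz_pmod a n_gt0.
case: (a %% n)%Z => // k k_lt _.
by rewrite -pmulrn val_Zp_nat // modn_small.
Qed.

Lemma intr_eqP (n : nat) (a c : int) : (1 < n)%N ->
  reflect (exists w : int, a = c + w * n%:Z) (a%:~R == c%:~R :> 'Z_n).
Proof.
move=> n_gt1; apply: (iffP eqP) => [eq_ac|[w ->]]; last exact: intr_addM.
have := val_intr a n_gt1; rewrite eq_ac val_intr // => /esym eq_mod.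
exists ((a %/ n)%Z - (c %/ n)%Z).
by rewrite [LHS](divz_eq a n) [X in _ = X + _](divz_eq c n) eq_mod; ring.
Qed.

Lemma intr_inj_small (n : nat) (a c : int) : (1 < n)%N ->
  - n%:Z < a - c < n%:Z -> a%:~R = c%:~R :> 'Z_n -> a = c.
Proof.
move=> n_gt1 hac /eqP/(intr_eqP _ _ n_gt1)[w eac].
have w0 : w = 0 by nia.
by rewrite eac w0 mul0r addr0.
Qed.

(** For residues of integers in [0, 2n), the only reductions that occur are
    none and one subtraction of n. *)
Lemma val_intr_lift (n : nat) (a : int) : (1 < n)%N -> 0 <= a < 2 * n%:Z ->
  let r := nat_of_ord (a%:~R : 'Z_n) in r%:Z = a \/ r%:Z = a - n%:Z.
Proof.
move=> n_gt1 ha /=; rewrite val_intr //.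
have := divz_eq a n; have n0 : n%:Z != 0 by lia.
have n_gt0 : (0 < n%:Z)%R by lia.
have := modz_ge0 a n0; have := ltz_pmod a n_gt0.
move: (a %% n)%Z (a %/ n)%Z => r w hr1 hr2 ea.
have : w = 0 \/ w = 1 by nia.
by case=> ew; [left|right]; rewrite ea ew; ring.
Qed.

Lemma val_Zp_succ (m : nat) (i : 'Z_m) : (1 < m)%N ->
  (i + 1 : 'Z_m) = (i.+1 %% m)%N :> nat.
Proof. by move=> m_gt1; rewrite -{1}(natr_Zp i) natr1 val_Zp_nat. Qed.

Lemma val_Zp_pred (m : nat) (i : 'Z_m) : (1 < m)%N -> (0 < i)%N ->
  (i - 1 : 'Z_m) = i.-1 :> nat.
Proof.
move=> m_gt1 i_gt0; rewrite -{1}(natr_Zp i) -(prednK i_gt0) -natr1 addrK.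
rewrite val_Zp_nat // modn_small //.
by rewrite (leq_ltn_trans (leq_pred _)) // -[X in (_ < X)%N](Zp_cast m_gt1).
Qed.

Lemma ltn_Zp (m : nat) (i : 'Z_m) : (1 < m)%N -> (i < m)%N.
Proof. by move=> m_gt1; rewrite -[X in (_ < X)%N](Zp_cast m_gt1). Qed.

Lemma additive_Zp (n : nat) (phi : {additive 'Z_n -> 'Z_n}) a : phi a = a * phi 1.
Proof. by rewrite -{1}(natr_Zp a) raddfMn -mulr_natl natr_Zp. Qed.

(** * Translating one set *)

(** The pairs at u and v have the same gap D and the pair at x has gap d. The
    translation by v - x - (x - u) + (D - d) reflects the pair at x between its
    two neighbours: with the complementary choice of elements in both pairs, a
    difference with one neighbour becomes a difference with the other. *)
Lemma swap_after (R : comPzRingType) (u x v d D : R) (s t : bool) :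
  (v + D *+ s) - (x + d *+ t) =
  (x + (v - x - (x - u) + (D - d)) + d *+ ~~ t) - (u + D *+ ~~ s).
Proof. by case: s t => -[] /=; ring. Qed.

Lemma swap_before (R : comPzRingType) (u x v d D : R) (s t : bool) :
  (x + d *+ s) - (u + D *+ t) =
  (v + D *+ ~~ t) - (x + (v - x - (x - u) + (D - d)) + d *+ ~~ s).
Proof. by case: s t => -[] /=; ring. Qed.

(** By the two identities above the steps into and out of index i exchange their
    differences. The inclusion is all that transferring a cover of the nonzero
    elements from A to A' requires. *)
Lemma ext_diffs_swap (n m : nat) (A A' : setseq 'Z_n m) (i : 'Z_m)
    (u x v D d : 'Z_n) :
    i + 1 != i -> A (i - 1) = [set u; u + D] -> A i = [set x; x + d] ->
    A (i + 1) = [set v; v + D] ->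
    let z := v - x - (x - u) + (D - d) in
    A' i = [set x + z; x + z + d] -> (forall j, j != i -> A' j = A j) ->
  {subset ext_diffs A <= ext_diffs A'}.
Proof.
move=> i1 Au Ax Av z A'i A'j g /ext_diffsP[j [a [c [ha hc ->]]]].
have i0 : i - 1 != i by apply: contraNneq i1 => e; rewrite -[X in X + 1]e subrK.
apply/ext_diffsP; have [ji|ji] := eqVneq j i.
  move: ha hc; rewrite {}ji Ax Av => /set2_addP[s ->] /set2_addP[t ->].
  exists (i - 1), (x + z + d *+ ~~ t), (u + D *+ ~~ s).
  rewrite subrK A'i A'j // Au; split; try by apply/set2_addP; eexists.
  exact: swap_after.
have [j1i|j1i] := eqVneq (j + 1) i.
  have ej : j = i - 1 by rewrite -j1i addrK.
  move: ha hc; rewrite j1i ej Ax Au => /set2_addP[s ->] /set2_addP[t ->].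
  exists i, (v + D *+ ~~ t), (x + z + d *+ ~~ s).
  rewrite A'i A'j // Av; split; try by apply/set2_addP; eexists.
  exact: swap_before.
by exists j, a, c; rewrite !A'j.
Qed.

(** * The values of x and d *)

(** The condition on b is equivalent to m >= 33. *)
Definition params (m b e : nat) : Prop :=
  [/\ (4 <= b)%N, (e <= 3)%N & m = (8 * b + 2 * e + 1)%N].

Ltac skip_guard := rewrite ifF; last (by lia).
Ltac take_guard := rewrite ifT; last (by lia).

(** The regimes of the formula for x_i, exhaustive for i < m. The conditions of
    each constructor already include the failure of the guards that precede it
    in the nested conditionals, so that a case analysis yields short linear
    arithmetic goals. *)
Variant index_spec (m b e i : nat) : int -> int -> Prop :=
| IndexEven of ~~ odd i & (i <= m - 3)%N :
    index_spec m b e i (2 * i%:Z) 1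
| IndexMod3 of (i %% 4 = 3)%N & (i <= 4 * b - 1)%N :
    index_spec m b e i (2 * m%:Z - 2 * i%:Z + 6) (2 * m%:Z - 2)
| IndexMod1 of (i %% 4 = 1)%N & (i <= 4 * b - 7)%N :
    index_spec m b e i (2 * m%:Z - 2 * i%:Z - 10) (2 * m%:Z - 2)
| IndexMid of i = (4 * b - 3)%N :
    index_spec m b e i (2 * m%:Z - 8 * b%:Z - 4 * ((e + 3) %/ 4)%N%:Z)
      (2 * m%:Z - 2)
| IndexHigh of odd i & (4 * b + 1 <= i <= m - 4)%N
    & (e < 3)%N || (4 * b + 5 <= i)%N :
    index_spec m b e i (4 * m%:Z - 2 * i%:Z - 10) (2 * m%:Z - 2)
| IndexSwap1 of e = 3 & i = (4 * b + 1)%N :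
    index_spec m b e i (m%:Z + 7) (2 * m%:Z - 2)
| IndexSwap3 of e = 3 & i = (4 * b + 3)%N :
    index_spec m b e i (3 * m%:Z - 5) (2 * m%:Z - 2)
| IndexPenultimate of i = (m - 2)%N :
    index_spec m b e i (2 * m%:Z - 7) 3
| IndexLast of i = (m - 1)%N :
    index_spec m b e i (2 * m%:Z - 1) (2 * m%:Z - 2).

Section Family.
Variables (m b e : nat).
Hypothesis par : params m b e.

Lemma d_even i : ~~ odd i -> (i <= m - 3)%N -> d_int m i = 1.
Proof. by case: par => hb he hm oi hi; rewrite /d_int /in_ap; take_guard. Qed.

Lemma d_odd i : (i < m)%N -> odd i -> i != (m - 2)%N -> d_int m i = 2 * m%:Z - 2.
Proof.
case: par => hb he hm hi oi ni; rewrite /d_int /in_ap; skip_guard.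
by case: ifP => // _; skip_guard.
Qed.

Lemma x_even i : ~~ odd i -> (i <= m - 3)%N -> x_int m b e i = 2 * i%:Z.
Proof.
by case: par => hb he hm oi hi;
rewrite /x_int /in_ap; do 2 skip_guard; take_guard.
Qed.

Lemma x_mod3 i : (i %% 4 = 3)%N -> (i <= 4 * b - 1)%N ->
  x_int m b e i = 2 * m%:Z - 2 * i%:Z + 6.
Proof.
by case: par => hb he hm oi hi;
rewrite /x_int /in_ap; do 3 skip_guard; take_guard.
Qed.

Lemma x_mod1 i : (i %% 4 = 1)%N -> (i <= 4 * b - 7)%N ->
  x_int m b e i = 2 * m%:Z - 2 * i%:Z - 10.
Proof.
by case: par => hb he hm oi hi;
rewrite /x_int /in_ap; do 4 skip_guard; take_guard.
Qed.

Lemma x_mid i : i = (4 * b - 3)%N ->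
  x_int m b e i = 2 * m%:Z - 8 * b%:Z - 4 * ((e + 3) %/ 4)%N%:Z.
Proof.
by case: par => hb he hm hi;
rewrite /x_int /in_ap; do 5 skip_guard; take_guard.
Qed.

Lemma x_high i : odd i -> (4 * b + 1 <= i <= m - 4)%N ->
    (e < 3)%N || (4 * b + 5 <= i)%N ->
  x_int m b e i = 4 * m%:Z - 2 * i%:Z - 10.
Proof.
by case: par => hb he hm oi hi hei;
rewrite /x_int /in_ap; do 6 skip_guard; take_guard.
Qed.

Lemma x_swap1 i : e = 3 -> i = (4 * b + 1)%N -> x_int m b e i = m%:Z + 7.
Proof. by case: par => hb he hm e3 hi; rewrite /x_int; take_guard. Qed.

Lemma x_swap3 i : e = 3 -> i = (4 * b + 3)%N -> x_int m b e i = 3 * m%:Z - 5.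
Proof.
by case: par => hb he hm e3 hi;
rewrite /x_int; skip_guard; take_guard.
Qed.

Lemma x_penultimate i : i = (m - 2)%N -> x_int m b e i = 2 * m%:Z - 7.
Proof.
by case: par => hb he hm hi;
rewrite /x_int /in_ap; do 7 skip_guard; take_guard.
Qed.

Lemma d_penultimate i : i = (m - 2)%N -> d_int m i = 3.
Proof.
by case: par => hb he hm hi;
rewrite /d_int /in_ap; do 2 skip_guard; take_guard.
Qed.

Lemma x_last i : i = (m - 1)%N -> x_int m b e i = 2 * m%:Z - 1.
Proof. by case: par => hb he hm hi; rewrite /x_int /in_ap; do 8 skip_guard. Qed.

Lemma d_last i : i = (m - 1)%N -> d_int m i = 2 * m%:Z - 2.
Proof. by case: par => hb he hm hi; rewrite /d_int /in_ap; do 3 skip_guard. Qed.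

Lemma indexP i : (i < m)%N -> index_spec m b e i (x_int m b e i) (d_int m i).
Proof.
move=> ltim; have [hb he hm] := par.
have [i1|/eqP ni1] := eqVneq i (m - 1)%N.
  by rewrite (x_last i1) (d_last i1); apply: IndexLast.
have [i2|/eqP ni2] := eqVneq i (m - 2)%N.
  by rewrite (x_penultimate i2) (d_penultimate i2); apply: IndexPenultimate.
have [oi|ei] := boolP (odd i); last first.
  by rewrite x_even ?d_even //; try lia; apply: IndexEven => //; lia.
rewrite d_odd //; last by lia.
have [i_mid|n_mid] := eqVneq i (4 * b - 3)%N.
  by rewrite x_mid //; apply: IndexMid.
have [lo|hi] := leqP i (4 * b).
  have [i3|i3] := eqVneq (i %% 4)%N 3.
    by rewrite x_mod3 //; try lia; apply: IndexMod3 => //; lia.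
  by rewrite x_mod1 //; try lia; apply: IndexMod1 => //; lia.
have [he5|he5] := boolP ((e < 3)%N || (4 * b + 5 <= i)%N).
  by rewrite x_high //; try lia; apply: IndexHigh => //; lia.
have [i1|i1] := eqVneq i (4 * b + 1)%N.
  by rewrite x_swap1 //; try lia; apply: IndexSwap1 => //; lia.
by rewrite x_swap3 //; try lia; apply: IndexSwap3 => //; lia.
Qed.

(** * Disjointness: the index from the element *)

(** A left inverse of the maps that send i to the residues of x_i and x_i + D;
    it spares a comparison of the regimes two by two. Apart from the last two
    sets, the residues 0 and 1 modulo 4 up to 2m - 5 come from even i; the other
    multiples of 4 and the residues 3 modulo 4 come from odd i > 4b, whose
    x_i + D may exceed 4m; the residues 2 modulo 4 come from odd i < 4b and, for
    e = 3, from 4b + 1. For the latter x_i is at most 2m and x_i + D is above 2m,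
    so [owner2] only has to recover i from x_i. *)
Definition owner2 (r : nat) : nat :=
  if (e == 3) && (r == m + 7)%N then (4 * b + 1)%N
  else if (r == 2 * m - 8 * b - 4 * ((e + 3) %/ 4))%N then (4 * b - 3)%N
  else if ((2 * m - r) %% 8 == 0)%N then (m + 3 - r %/ 2)%N
  else (m - 5 - r %/ 2)%N.

Definition owner (r : nat) : nat :=
  if (r %% 4 == 0)%N then
    if (r <= 2 * m - 6)%N then (r %/ 2)%N
    else if (4 * m - 4 <= r)%N then (3 * m - 6 - r %/ 2)%N
    else if (e == 3) && (r == 3 * m - 5)%N then (4 * b + 3)%N
    else (2 * m - 5 - r %/ 2)%N
  else if (r %% 4 == 1)%N then
    if (2 * m - 1 <= r)%N then (m - 1)%N else (r %/ 2)%N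
  else if (r %% 4 == 3)%N then
    if r == (2 * m - 7)%N then (m - 2)%N
    else if (e == 3) && (r == m - 8)%N then (4 * b + 3)%N
    else (m - 7 - r %/ 2)%N
  else if r == (2 * m - 4)%N then (m - 2)%N
  else if (r <= 2 * m)%N then owner2 r else owner2 (r - (2 * m - 2)).

(** A superset of the residues covered by the sets A_i, coarse enough for a
    one-line description and fine enough to exclude the translated pairs. *)
Definition occupied (r : nat) : bool :=
  [|| (r %% 4 == 0) && ((r <= 3 * m - 5) || (4 * m - 4 <= r)),
      (r %% 4 == 1) && [|| r <= 2 * m - 5, r == 2 * m - 1 | r == 4 * m - 3],
      (r %% 4 == 2) && ((r <= 2 * m) || (3 * m - 3 <= r))
    | (r %% 4 == 3) && (r <= 2 * m - 7)]%N.

Ltac decide_guard := first [ skip_guard | take_guard ].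

Lemma owner_point i (s : bool) (r : nat) : (i < m)%N -> (r <= 4 * m)%N ->
  let y := x_int m b e i + s%:Z * d_int m i in
  r%:Z = y \/ r%:Z = y - (4 * m%:Z + 1) -> owner r = i /\ occupied r.
Proof.
move=> ltim ltr /=; have [hb he hm] := par.
case: (indexP ltim) => [?? | ?? | ?? | ? | ??? | ?? | ?? | ? | ?]; case: s;
  rewrite /= ?mul0r ?mul1r ?addr0; case=> yr; try (exfalso; lia).
all: split; [by rewrite /owner /owner2; repeat decide_guard; lia|].
all: rewrite /occupied; apply/or4P.
all: first [ by apply: Or41; lia | by apply: Or42; lia
           | by apply: Or43; lia | by apply: Or44; lia ].
Qed.

(** * The differences cover the nonzero residues *)

(** The left alternative is the step from j - 1 to j, where c = x_j - x_(j-1);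
    the right one is the step from j to j + 1, where c is x_(j+1) - x_j + 1 - D
    modulo 4m + 1. *)
Definition block (c : nat) : Prop :=
  exists2 j : nat, odd j && (j <= m - 4)%N &
    x_int m b e j - 2 * j%:Z + 2 = c%:Z \/
    2 * j%:Z + 5 - x_int m b e j - 2 * m%:Z = c%:Z - (4 * m%:Z + 1).

Lemma block_mod3_before t : (t < b)%N -> block (2 * m - 4 - 16 * t).
Proof.
case: par => hb he hm ht; exists (4 * t + 3)%N; first lia.
by left; rewrite x_mod3; lia.
Qed.

Lemma block_mod3_after t : (t < b)%N -> block (16 * t + 12).
Proof.
case: par => hb he hm ht; exists (4 * t + 3)%N; first lia.
by right; rewrite x_mod3; lia.
Qed.

Lemma block_mod1_before t : (t + 2 <= b)%N -> block (2 * m - 12 - 16 * t).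
Proof.
case: par => hb he hm ht; exists (4 * t + 1)%N; first lia.
by left; rewrite x_mod1; lia.
Qed.

Lemma block_mod1_after t : (t + 2 <= b)%N -> block (16 * t + 20).
Proof.
case: par => hb he hm ht; exists (4 * t + 1)%N; first lia.
by right; rewrite x_mod1; lia.
Qed.

Lemma block_high_before t : (2 * t + 4 * b + 5 <= m)%N ->
  (e < 3)%N || (2 * t + 4 * b + 9 <= m)%N -> block (8 * t + 8).
Proof.
case: par => hb he hm ht het; exists (m - 4 - 2 * t)%N; first lia.
by left; rewrite x_high; lia.
Qed.

Lemma block_high_after t : (2 * t + 4 * b + 5 <= m)%N ->
  (e < 3)%N || (2 * t + 4 * b + 9 <= m)%N -> block (2 * m - 8 * t).
Proof.
case: par => hb he hm ht het; exists (m - 4 - 2 * t)%N; first lia.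
by right; rewrite x_high; lia.
Qed.

Lemma block_mid_before c : (c + 4 * ((e + 3) %/ 4) = 4 * e + 10)%N -> block c.
Proof.
case: par => hb he hm hc; exists (4 * b - 3)%N; first lia.
by left; rewrite x_mid //; lia.
Qed.

Lemma block_mid_after : block (16 * b + 4 * ((e + 3) %/ 4)).
Proof.
case: par => hb he hm; exists (4 * b - 3)%N; first lia.
by right; rewrite x_mid //; lia.
Qed.

Lemma block_swap : e = 3 ->
  [/\ block 10, block 14, block (16 * b + 8) & block (16 * b + 12)].
Proof.
case: par => hb he hm e3; split.
- by exists (4 * b + 3)%N; [lia | right; rewrite x_swap3 //; lia].
- by exists (4 * b + 1)%N; [lia | left; rewrite x_swap1 //; lia].
- by exists (4 * b + 1)%N; [lia | right; rewrite x_swap1 //; lia].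
by exists (4 * b + 3)%N; [lia | left; rewrite x_swap3 //; lia].
Qed.

(** The steps after odd j < 4b give the multiples 12, 20, 28, ... of 4 and the
    steps before odd j > 4b give 8, 16, 24, ...; the numbers congruent to 2
    modulo 4 arise likewise from the top 2m downwards. The progressions break off
    near c = 16b and c = 4e + 10, where the index 4b - 3 and, for e = 3, the
    exchanged values at 4b + 1 and 4b + 3 fill the gaps. *)
Lemma block_cover (c : nat) : ~~ odd c -> (8 <= c <= 2 * m)%N -> block c.
Proof.
move=> ec /andP[c_ge c_le]; have [hb he hm] := par.
have [k dc] : exists k, c = (4 * k)%N \/ c = (2 * m - 4 * k)%N.
  have [c0|c2] := eqVneq (c %% 4)%N 0%N; first by exists (c %/ 4)%N; lia.
  by exists ((2 * m - c) %/ 4)%N; right; lia.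
have [t dk] : exists t, [\/ k = (2 * t)%N, k = (4 * t + 1)%N | k = (4 * t + 3)%N].
  have [k1|k0] := boolP (odd k); last by exists (k./2); apply: Or31; lia.
  have [k2|k2] := boolP (odd k./2); exists (k %/ 4)%N; last by apply: Or32; lia.
  by apply: Or33; lia.
case: dc dk => dc [] dk.
- have [/andP[/eqP e0 tb]|n0] := boolP ((e == 0) && (t == 2 * b))%N.
    have -> : c = (16 * b + 4 * ((e + 3) %/ 4))%N by rewrite e0; lia.
    exact: block_mid_after.
  have [/andP[/eqP e3 tb]|n3] := boolP ((e == 3) && (t == 2 * b + 1))%N.
    have -> : c = (16 * b + 8)%N by lia.
    by case: (block_swap e3).
  have -> : c = (8 * t.-1 + 8)%N by lia.
  by apply: block_high_before; lia.
- have [tb|bt] := leqP t.+1 b.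
    have -> : c = (16 * t.-1 + 20)%N by lia.
    by apply: block_mod1_after; lia.
  have -> : c = (16 * b + 4 * ((e + 3) %/ 4))%N by lia.
  exact: block_mid_after.
- have [tb|bt] := ltnP t b.
    have -> : c = (16 * t + 12)%N by lia.
    exact: block_mod3_after.
  have e3 : e = 3 by lia.
  have -> : c = (16 * b + 12)%N by lia.
  by case: (block_swap e3).
- have [/andP[/eqP e0 tb]|n0] := boolP ((e == 0) && (t == 2 * b - 1))%N.
    by apply: block_mid_before; rewrite e0; lia.
  have [/andP[/eqP e3 tb]|n3] := boolP ((e == 3) && (t == 2 * b))%N.
    have -> : c = 14 by lia.
    by case: (block_swap e3).
  have -> : c = (2 * m - 8 * t)%N by lia.
  by apply: block_high_after; lia.
- have [tb|bt] := ltnP t b.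
    have -> : c = (2 * m - 4 - 16 * t)%N by lia.
    exact: block_mod3_before.
  have e3 : e = 3 by lia.
  have -> : c = 10 by lia.
  by case: (block_swap e3).
have [tb|bt] := leqP (t + 2) b.
  have -> : c = (2 * m - 12 - 16 * t)%N by lia.
  exact: block_mod1_before.
by apply: block_mid_before; lia.
Qed.

Definition is_diff (a : int) : Prop :=
  exists i j (s t : bool), [/\ (i < m)%N, j = (i.+1 %% m)%N &
    (x_int m b e j + s%:Z * d_int m j) - (x_int m b e i + t%:Z * d_int m i) = a].

Lemma is_diff_to_penultimate (s t : bool) : is_diff (3 * s%:Z - t%:Z - 1).
Proof.
have [hb he hm] := par; exists (m - 3)%N, (m - 2)%N, s, t.
split; [lia | rewrite modn_small; lia |].
rewrite (@x_penultimate (m - 2)) // (@d_penultimate (m - 2)) //.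
by rewrite (@x_even (m - 3)) ?(@d_even (m - 3)) //; lia.
Qed.

Lemma is_diff_to_last (s t : bool) :
  is_diff (6 + s%:Z * (2 * m%:Z - 2) - 3 * t%:Z).
Proof.
have [hb he hm] := par; exists (m - 2)%N, (m - 1)%N, s, t.
split; [lia | rewrite modn_small; lia |].
rewrite (@x_penultimate (m - 2)) // (@d_penultimate (m - 2)) //.
by rewrite (@x_last (m - 1)) // (@d_last (m - 1)) //; lia.
Qed.

Lemma is_diff_from_last (s t : bool) :
  is_diff (1 - 2 * m%:Z + s%:Z - t%:Z * (2 * m%:Z - 2)).
Proof.
have [hb he hm] := par; exists (m - 1)%N, 0%N, s, t; split; [lia | | ].
  by have -> : ((m - 1).+1 = m)%N by [lia]; rewrite modnn.
rewrite (@x_last (m - 1)) // (@d_last (m - 1)) //.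
by rewrite (@x_even 0) ?(@d_even 0) //; lia.
Qed.

Lemma diff_cover (r : nat) : (0 < r <= 4 * m)%N ->
  exists w : int, is_diff (r%:Z + w * (4 * m%:Z + 1)).
Proof.
move=> hr; have [hb he hm] := par.
have [hr'|hr'] := boolP ((7 <= r <= 2 * m) || (2 * m + 5 <= r <= 4 * m - 2))%N.
  (* r = c - p + h D, where c is the first even number from r - h D on *)
  have [h [r' [er hr1]]] : exists (h : bool) (r' : nat),
      r%:Z = r'%:Z + h%:Z * (2 * m%:Z - 2) /\ (7 <= r' <= 2 * m)%N.
    case/orP: hr' => ?; first by exists false, r; lia.
    by exists true, (r - (2 * m - 2))%N; lia.
  have [p ep] : exists p : bool, ~~ odd (r' + p).
    by exists (odd r'); rewrite oddD oddb addbb.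
  have [|j hj [xj|xj]] := block_cover ep; first by case: p ep => /=; lia.
    exists 0, j.-1, j, h, p; split; [lia | by rewrite modn_small; lia |].
    rewrite (@d_odd j) ?(@d_even j.-1) ?(@x_even j.-1); lia.
  exists (-1), j, j.+1, (~~ p), (~~ h).
  split; [lia | by rewrite modn_small; lia |].
  rewrite (@d_odd j) ?(@d_even j.+1) ?(@x_even j.+1); lia.
have use (a w : int) : is_diff a -> a = r%:Z + w * (4 * m%:Z + 1) ->
    exists w, is_diff (r%:Z + w * (4 * m%:Z + 1)).
  by move=> ha ea; exists w; rewrite -ea.
have : r \in [:: 1; 2; 3; 4; 5; 6; 2 * m + 1; 2 * m + 2; 2 * m + 3; 2 * m + 4;
                 4 * m - 1; 4 * m]%N.
  by move: hr'; rewrite !inE; lia.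
rewrite !inE; repeat case/orP; move=> /eqP hr1.
- by apply: (use _ 0 (is_diff_to_penultimate true true)); rewrite hr1; lia.
- by apply: (use _ 0 (is_diff_to_penultimate true false)); rewrite hr1; lia.
- by apply: (use _ 0 (is_diff_to_last false true)); rewrite hr1; lia.
- by apply: (use _ (-1) (is_diff_from_last false true)); rewrite hr1; lia.
- by apply: (use _ (-1) (is_diff_from_last true true)); rewrite hr1; lia.
- by apply: (use _ 0 (is_diff_to_last false false)); rewrite hr1; lia.
- by apply: (use _ 0 (is_diff_to_last true true)); rewrite hr1; lia.
- by apply: (use _ (-1) (is_diff_from_last false false)); rewrite hr1; lia.
- by apply: (use _ (-1) (is_diff_from_last true false)); rewrite hr1; lia.
- by apply: (use _ 0 (is_diff_to_last true false)); rewrite hr1; lia.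
- by apply: (use _ (-1) (is_diff_to_penultimate false true)); rewrite hr1; lia.
by apply: (use _ (-1) (is_diff_to_penultimate false false)); rewrite hr1; lia.
Qed.

(** * The translated pairs *)

(** With 4b = 12q + 4y, the condition 4b - 4q + 4 <= i <= 4b + 4q - 4 is the
    range of the set I, and 4b + 2[e = 3] is the index removed from it. *)
Definition shiftable (q i : nat) : bool :=
  [&& ~~ odd i, 4 * b - 4 * q + 4 <= i <= 4 * b + 4 * q - 4
    & i != 4 * b + 2 * (e == 3)]%N.

Lemma shiftable_bounds q i : (3 * q <= b <= 3 * q + 2)%N ->
  shiftable q i -> (4 <= i <= m - 5)%N.
Proof. by have [hb he hm] := par => hbq; case/and3P=> ei hi _; lia. Qed.

(** The integer on the left represents x_i + z_i, as d_(i+1) - d_i = D - 1.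
    Up to the centre 4b of the range its residue r is 3 modulo 4, while A covers
    no residue 3 modulo 4 beyond 2m and no multiple of 4 strictly between 3m - 5
    and 4m - 4. Past the centre r is 2 modulo 4 and lies strictly between 2m and
    3m - 3, where A covers no residue 2 or 3 modulo 4. *)
Lemma shift_free (q i : nat) :
    (3 * q <= b <= 3 * q + 2)%N -> shiftable q i ->
  exists (r : nat) (w : int), [/\ (r < 4 * m)%N, ~~ occupied r, ~~ occupied r.+1 &
    x_int m b e i.+1 - x_int m b e i + x_int m b e i.-1 + (2 * m%:Z - 3) =
    r%:Z + w * (4 * m%:Z + 1)].
Proof.
move=> hbq /and3P[ei hi ni]; have [hb he hm] := par.
have free3 (r : nat) : (r %% 4 = 3)%N -> (3 * m - 5 <= r <= 4 * m - 6)%N ->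
  [/\ (r < 4 * m)%N, ~~ occupied r & ~~ occupied r.+1].
  move=> r3 hr; have r4 : (r.+1 %% 4 = 0)%N by lia.
  by split; rewrite /occupied ?r3 ?r4 /=; lia.
have free2 (r : nat) : (r %% 4 = 2)%N -> (2 * m < r < 3 * m - 3)%N ->
  [/\ (r < 4 * m)%N, ~~ occupied r & ~~ occupied r.+1].
  move=> r2 hr; have r4 : (r.+1 %% 4 = 3)%N by lia.
  by split; rewrite /occupied ?r2 ?r4 /=; lia.
have sol (r : nat) (w : int) :
    [/\ (r < 4 * m)%N, ~~ occupied r & ~~ occupied r.+1] ->
    x_int m b e i.+1 - x_int m b e i + x_int m b e i.-1 + (2 * m%:Z - 3) =
    r%:Z + w * (4 * m%:Z + 1) ->
  exists (r : nat) (w : int), [/\ (r < 4 * m)%N, ~~ occupied r, ~~ occupied r.+1 &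
    x_int m b e i.+1 - x_int m b e i + x_int m b e i.-1 + (2 * m%:Z - 3) =
    r%:Z + w * (4 * m%:Z + 1)].
  by case=> ? ? ? ?; exists r, w.
have n_half : (1 < i)%N by lia.
have xi : x_int m b e i = 2 * i%:Z by rewrite x_even //; lia.
rewrite xi in sol *.
(* naming the rounded quotient keeps the divisions out of the linear goals *)
have [dl edl hdl] : exists2 dl : nat, dl = ((e + 3) %/ 4)%N & (dl <= 1)%N.
  by exists ((e + 3) %/ 4)%N => //; lia.
have [i_mid|n1] := eqVneq i (4 * b)%N.
  have {ni n_half hi}e3 : e = 3 by move: ni; rewrite i_mid; case: eqP; lia.
  apply: (sol (3 * m + 26)%N 0); first by apply: free3; lia.
  by rewrite x_swap1 ?x_mod3; lia.
have [i_mid1|n2] := eqVneq i (4 * b - 2)%N.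
  clear ni hi n1 n_half hbq.
  apply: (sol (6 * m - 3 - 6 * i - 4 * dl)%N 0); first by apply: free3; lia.
  by rewrite x_mod3 ?x_mid -?edl; lia.
have [i_mid2|n3] := eqVneq i (4 * b - 4)%N.
  have {}hb : (6 <= b)%N by lia.
  clear ni hi n1 n2 n_half hbq.
  apply: (sol (6 * m - 3 - 6 * i - 4 * dl)%N 0); first by apply: free3; lia.
  by rewrite x_mid ?x_mod3 -?edl; lia.
have [lo|hi'] := leqP i (4 * b).
  clear ni edl hdl.
  have hlo : (2 * m + 10 <= 6 * i)%N by clear n1 n2 n3; lia.
  have {}lo : (i <= 4 * b - 6)%N by clear hi hbq hlo; lia.
  clear hi n1 n2 n3 hbq.
  apply: (sol (6 * m - 7 - 6 * i)%N 0); first by apply: free3; lia.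
  have [i0|i2] := eqVneq (i %% 4)%N 0%N.
    by rewrite (@x_mod1 i.+1) ?(@x_mod3 i.-1); lia.
  by rewrite (@x_mod3 i.+1) ?(@x_mod1 i.-1); lia.
clear n1 n2 n3 edl hdl.
have [{}hi hi1] : (6 * i <= 4 * m - 25)%N /\ (i <= m - 5)%N by clear ni; lia.
have {}hi' : (4 * b + 2 <= i)%N by clear ni hbq hi hi1; lia.
clear hbq.
have [e3|ne3] := eqVneq e 3.
  have {ni}hi'' : (4 * b + 4 <= i)%N by move: ni; rewrite e3; lia.
  have [i4|n4] := eqVneq i (4 * b + 4)%N.
    apply: (sol (3 * m - 23)%N 1); first by apply: free2; lia.
    by rewrite x_high ?x_swap3; lia.
  apply: (sol (6 * m - 24 - 6 * i)%N 1); first by apply: free2; lia.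
  by rewrite (@x_high i.+1) ?(@x_high i.-1); lia.
clear ni; have {ne3}he3 : (e < 3)%N by lia.
apply: (sol (6 * m - 24 - 6 * i)%N 1); first by apply: free2; lia.
by rewrite (@x_high i.+1) ?(@x_high i.-1) ?he3; lia.
Qed.

(** * The sequences are CEDFs *)

Let A := A_seq m b e.

Let m_gt1 : (1 < m)%N. Proof. by case: par; lia. Qed.
Let v_gt1 : (1 < 4 * m + 1)%N. Proof. lia. Qed.
Let vE : (4 * m + 1)%N%:Z = 4 * m%:Z + 1. Proof. lia. Qed.

Lemma lift_bound i (s : bool) : (i < m)%N ->
  0 <= x_int m b e i + s%:Z * d_int m i < 2 * (4 * m%:Z + 1).
Proof.
move=> ltim; have [hb he hm] := par.
by case: (indexP ltim) => [?? | ?? | ?? | ? | ??? | ?? | ?? | ? | ?];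
  case: s; lia.
Qed.

Lemma A_seqE i : A i = [set x_seq b e i; x_seq b e i + d_seq i].
Proof. by rewrite ffunE. Qed.

Lemma x_seqDd (i : 'Z_m) (s : bool) :
  x_seq b e i + d_seq i *+ s = (x_int m b e i + s%:Z * d_int m i)%:~R.
Proof. by rewrite intrD intrM mulr_natl. Qed.

Lemma mem_A_seq (i : 'Z_m) (a : 'Z_(4 * m + 1)) : a \in A i ->
  owner a = i /\ occupied a.
Proof.
rewrite A_seqE => /set2_addP[s ->]; rewrite x_seqDd.
have ltim := ltn_Zp i m_gt1; have hy := lift_bound s ltim.
have := @val_intr_lift (4 * m + 1) (x_int m b e i + s%:Z * d_int m i) v_gt1.
rewrite vE => /(_ hy) => hr; apply: (owner_point ltim) hr.
by have := ltn_Zp (x_int m b e i + s%:Z * d_int m i)%:~R v_gt1; lia.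
Qed.

Lemma d_int_cases i : (i < m)%N ->
  [\/ d_int m i = 1, d_int m i = 2 * m%:Z - 2 | i = (m - 2)%N].
Proof.
case/indexP => *; by [apply: Or31 | apply: Or32 | apply: Or33].
Qed.

Lemma d_seq_neq0 (i : 'Z_m) : d_seq i != 0.
Proof.
have [hb he hm] := par.
apply/eqP => /(@intr_inj_small _ _ 0 v_gt1).
have [->|->|->] := d_int_cases (ltn_Zp i m_gt1); try lia.
by rewrite d_penultimate //; lia.
Qed.

Lemma A_seq_disjoint (i j : 'Z_m) : i != j -> [disjoint A i & A j].
Proof.
move=> ij; apply/pred0P => a /=; apply/andP => -[/mem_A_seq[oi _] /mem_A_seq[oj _]].
by case/eqP: ij; apply: val_inj; rewrite /= -oi -oj.
Qed.

Lemma A_seq_cover (g : 'Z_(4 * m + 1)) : g != 0 -> g \in ext_diffs A.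
Proof.
move=> g0; have hg : (0 < g <= 4 * m)%N.
  have := ltn_Zp g v_gt1; suff : (0 < g)%N by lia.
  by rewrite lt0n; apply: contraNneq g0 => g0; apply/eqP/val_inj.
have [w [i [j [s [t [ltim ej eg]]]]]] := diff_cover hg.
have inpE : (inZp i : 'Z_m) = i :> nat by rewrite /= Zp_cast // modn_small.
have inpS : (inZp i + 1 : 'Z_m) = j :> nat by rewrite val_Zp_succ // inpE.
apply/ext_diffsP; exists (inZp i), (x_seq b e (inZp i + 1) + d_seq (inZp i + 1) *+ s),
  (x_seq b e (inZp i) + d_seq (inZp i) *+ t).
rewrite !A_seqE; split; try by apply/set2_addP; eexists.
rewrite !x_seqDd inpE inpS -intrB eg -vE intr_addM //.
by rewrite -pmulrn natr_Zp.
Qed.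

Lemma CEDF_A_seq : is_CEDF (4 * m + 1) m 2 1 A.
Proof.
apply: CEDF_criterion => //; last exact: A_seq_cover; last exact: A_seq_disjoint.
- by rewrite card_ord Zp_cast.
- by rewrite addn1 mulnC.
move=> i; rewrite A_seqE cards2 -[X in X != _]addr0 (inj_eq (addrI _)).
by rewrite eq_sym d_seq_neq0.
Qed.

Lemma A_assocE (i : 'Z_m) :
  A_assoc b e i i =
  [set x_seq b e i + z_shift b e i; x_seq b e i + z_shift b e i + d_seq i].
Proof.
rewrite ffunE eqxx [A_seq _ _ _ _]A_seqE.
by rewrite (imset_add_set2 (f := id) _ (erefl _)).
Qed.

Lemma A_assoc_other (i j : 'Z_m) : j != i -> A_assoc b e i j = A j.
Proof. by rewrite ffunE => /negbTE ->. Qed.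

Section Shift.
Variable q : nat.
Hypothesis hbq : (3 * q <= b <= 3 * q + 2)%N.

Lemma x_seq_shift (i : 'Z_m) (s : bool) : shiftable q i ->
  x_seq b e i + z_shift b e i + d_seq i *+ s =
  (x_int m b e i.+1 - x_int m b e i + x_int m b e i.-1
     + (2 * m%:Z - 3) + s%:Z)%:~R.
Proof.
move=> hi; have hb := shiftable_bounds hbq hi; case/and3P: hi => ei hi _.
have iS : (i + 1 : 'Z_m) = i.+1 :> nat by rewrite val_Zp_succ // modn_small; lia.
have iP : (i - 1 : 'Z_m) = i.-1 :> nat by rewrite val_Zp_pred //; lia.
rewrite /z_shift /x_seq /d_seq iS iP (@d_odd i.+1); try lia.
rewrite (@d_even i) //; try lia.
rewrite -[1%:~R *+ s]mulr_natl (pmulrn _ s) -intrM -!(intrB, intrD).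
by congr (_%:~R); ring.
Qed.

Lemma shifted_free (i a : _) : shiftable q (i : 'Z_m) ->
  a \in A_assoc b e i i -> ~~ occupied a.
Proof.
move=> hi; rewrite A_assocE => /set2_addP[s ->]; rewrite x_seq_shift //.
have [r [w [ltr f0 f1 ->]]] := shift_free hbq hi.
rewrite addrAC -PoszD -vE intr_addM // -pmulrn val_Zp_nat // modn_small; last lia.
by case: s; rewrite ?addn1 ?addn0.
Qed.

Lemma A_assoc_disjoint (i : 'Z_m) : shiftable q i ->
  forall j k : 'Z_m, j != k -> [disjoint A_assoc b e i j & A_assoc b e i k].
Proof.
move=> hi; have free j : j != i -> [disjoint A_assoc b e i i & A_assoc b e i j].
  move=> ji; apply/pred0P => a /=; apply/andP => -[/(shifted_free hi)/negP f].
  by rewrite A_assoc_other // => /mem_A_seq[].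
move=> j k jk; have [ji|ji] := eqVneq j i.
  by rewrite ji free // -ji eq_sym.
have [->|ki] := eqVneq k i; first by rewrite disjoint_sym free.
by rewrite !A_assoc_other // A_seq_disjoint.
Qed.

Lemma CEDF_A_assoc (i : 'Z_m) : shiftable q i ->
  is_CEDF (4 * m + 1) m 2 1 (A_assoc b e i).
Proof.
move=> hi; have hb := shiftable_bounds hbq hi; have [ei _ _] := and3P hi.
have iS : (i + 1 : 'Z_m) = i.+1 :> nat by rewrite val_Zp_succ // modn_small; lia.
have iP : (i - 1 : 'Z_m) = i.-1 :> nat by rewrite val_Zp_pred //; lia.
apply: CEDF_criterion => //.
- by rewrite card_ord Zp_cast.
- by rewrite addn1 mulnC.
- move=> j; have [->|ji] := eqVneq j i.
    rewrite A_assocE cards2 -[X in X != _]addr0 (inj_eq (addrI _)).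
    by rewrite eq_sym d_seq_neq0.
  by rewrite A_assoc_other //; have [_ _ -> _ _] := CEDF_A_seq.
- exact: A_assoc_disjoint.
move=> g /A_seq_cover; apply: (@ext_diffs_swap _ _ _ _ i
  (x_seq b e (i - 1)) (x_seq b e i) (x_seq b e (i + 1)) (d_seq (i + 1)) (d_seq i)).
- by apply/eqP => /(congr1 (@nat_of_ord _)); rewrite iS; lia.
- rewrite A_seqE; congr [set _; _ + _].
  by rewrite /d_seq iS iP (@d_odd i.-1) ?(@d_odd i.+1) //; lia.
- exact: A_seqE.
- exact: A_seqE.
- exact: A_assocE.
exact: A_assoc_other.
Qed.

Lemma A_assoc_new (i : 'Z_m) : shiftable q i -> A_assoc b e i i != A i.
Proof.
move=> hi; apply/eqP => eqA.
have xA : x_seq b e i \in A i by rewrite A_seqE !inE eqxx.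
have /negP[] : ~~ occupied (x_seq b e i).
  by apply: shifted_free hi _; rewrite eqA.
by have [] := mem_A_seq xA.
Qed.

End Shift.

(** * Inequivalence *)

(** The properties shared by all the sequences under consideration that pin
    down an equivalence: the indices 0 and 2 are never translated. *)
Definition framed (B : setseq 'Z_(4 * m + 1) m) : Prop :=
  [/\ forall j, exists x, B j = [set x; x + d_seq j],
      B 0 = [set 0%:~R; 1%:~R] & B 2%:R = [set 4%:~R; 5%:~R]].

Lemma val_Zm_nat k : (k < m)%N -> (k%:R : 'Z_m) = k :> nat.
Proof. by move=> ltkm; rewrite val_Zp_nat // modn_small. Qed.

Lemma framed_A_seq : framed A.
Proof.
have [hb he hm] := par.
split=> [j||]; first by exists (x_seq b e j); rewrite A_seqE.
  rewrite A_seqE /x_seq /d_seq -intrD.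
  by rewrite (@x_even 0) ?(@d_even 0).
rewrite A_seqE /x_seq /d_seq -intrD val_Zm_nat; last lia.
by rewrite (@x_even 2) ?(@d_even 2) //; lia.
Qed.

Lemma framed_A_assoc (q : nat) (i : 'Z_m) : (3 * q <= b <= 3 * q + 2)%N ->
  shiftable q i -> framed (A_assoc b e i).
Proof.
move=> hbq hi; have [hb he hm] := par; have hib := shiftable_bounds hbq hi.
have [Aj A0 A2] := framed_A_seq; split=> [j||].
- have [->|ji] := eqVneq j i; first by eexists; apply: A_assocE.
  by rewrite A_assoc_other.
- by rewrite A_assoc_other //; apply/eqP => /(congr1 (@nat_of_ord _)) /=; lia.
rewrite A_assoc_other //; apply/eqP => /(congr1 (@nat_of_ord _)).
by rewrite val_Zm_nat; lia.
Qed.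

(** With [d_seq_repeated] this makes m - 2 the only index whose gap, up to sign,
    is unique, so that every equivalence fixes it. *)
Lemma d_seq_penultimate (k p : 'Z_m) : p = (m - 2)%N :> nat ->
  d_seq k = d_seq p \/ d_seq k = - d_seq p -> k = p.
Proof.
move=> ep; have [hb he hm] := par; rewrite /d_seq (d_penultimate ep) -intrN.
have := d_int_cases (ltn_Zp k m_gt1).
case=> [->|->|ek _]; last by apply: val_inj; rewrite /= ek ep.
  by case=> /intr_inj_small; lia.
by case=> /intr_inj_small; lia.
Qed.

Lemma d_seq_repeated (i p : 'Z_m) : p = (m - 2)%N :> nat -> i != p ->
  exists2 j, j != i & d_seq j = d_seq i :> 'Z_(4 * m + 1).
Proof.
move=> ep ip; have [hb he hm] := par.
have neq k : (k < m)%N -> (k%:R != i) = (k != i)%N.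
  by move=> ltkm; rewrite -(inj_eq val_inj) /= val_Zm_nat.
have [di|di|ei] := d_int_cases (ltn_Zp i m_gt1).
- have [i0|i0] := eqVneq (nat_of_ord i) 0%N.
    exists 2%:R; first by rewrite neq; lia.
    by rewrite /d_seq val_Zm_nat ?di ?d_even //; lia.
  exists 0%:R; first by rewrite neq; lia.
  by rewrite /d_seq val_Zm_nat ?di ?d_even //; lia.
- have [i1|i1] := eqVneq (nat_of_ord i) 1%N.
    exists 3%:R; first by rewrite neq; lia.
    by rewrite /d_seq val_Zm_nat ?di ?d_odd //; lia.
  exists 1%:R; first by rewrite neq; lia.
  by rewrite /d_seq val_Zm_nat ?di ?d_odd //; lia.
by case/eqP: ip; apply: val_inj; rewrite /= ei ep.
Qed.

(** Comparing the gaps d_i shows that the rotation is trivial and that phi is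
    the multiplication by s = 1 or s = -1; the pairs {0, 1} and {4, 5} then force
    s = 1 and a translation by 0. *)
Lemma framed_equiv_eq (B C : setseq 'Z_(4 * m + 1) m) :
  framed B -> framed C -> CEDF_equiv B C -> B = C.
Proof.
move=> [pairB B0 B2] [pairC C0 C2] [phi [g [z [_ eqBC]]]].
have [hb he hm] := par.
have phid j : phi (d_seq j) = d_seq (j + z) \/ phi (d_seq j) = - d_seq (j + z).
  have [x Bx] := pairB j; have [y Cy] := pairC (j + z).
  have := eqBC j; rewrite Bx Cy (imset_add_set2 _ (raddfD phi x _)).
  exact: set2_add_inj.
pose p : 'Z_m := (m - 2)%:R.
have ep : p = (m - 2)%N :> nat by rewrite val_Zm_nat //; lia.
have z0 : z = 0.
  (* otherwise phi maps a repeated gap to the gap 3, up to sign *)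
  apply/eqP/negP => /negP z0; have ip : p - z != p.
    by apply: contra_neq z0 => e1; rewrite -[z]opprK -[- z](addKr p) e1 addNr oppr0.
  have [j ji dj] := d_seq_repeated ep ip.
  have jp : j + z != p by apply: contra_neq ji => <-; rewrite addrK.
  case/eqP: jp; apply: (d_seq_penultimate ep).
  have := phid (p - z); rewrite subrK -dj; exact: eq_up_to_sign (phid j).
move: eqBC phid; rewrite {}z0 => eqBC phid.
have eqBC' j : [set phi a + g | a in B j] = C j by rewrite eqBC addr0.
have [s hs phi1] : exists2 s : int, s = 1 \/ s = - 1 & phi 1 = s%:~R.
  have := phid 0; rewrite addr0 /d_seq (@d_even 0) //.
  by case=> ?; [exists 1 | exists (-1)]; auto; rewrite intrN.
have phiE a : phi a%:~R = (a * s)%:~R by rewrite additive_Zp phi1 intrM.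
have memC j a : a \in B j -> phi a + g \in C j.
  by move=> Ba; rewrite -eqBC'; apply: imset_f.
have [t ht gt] : exists2 t : int, t = 0 \/ t = 1 & g = t%:~R.
  have := memC 0 0%:~R; rewrite B0 C0 !inE eqxx => /(_ isT).
  by rewrite phiE mul0r add0r => /orP[] /eqP; [exists 0 | exists 1]; auto.
have t0 : 1 * s + t = 0 \/ 1 * s + t = 1.
  have := memC 0 1%:~R; rewrite B0 C0 !inE eqxx orbT => /(_ isT).
  rewrite phiE gt -intrD => /orP[] /eqP /(intr_inj_small v_gt1); lia.
have t4 : 4 * s + t = 4 \/ 4 * s + t = 5.
  have := memC 2%:R 4%:~R; rewrite B2 C2 !inE eqxx => /(_ isT).
  rewrite phiE gt -intrD => /orP[] /eqP /(intr_inj_small v_gt1); lia.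
have [s1 t1] : s = 1 /\ t = 0 by lia.
apply/ffunP => j; rewrite -eqBC' -[LHS]imset_id; apply: eq_imset => a.
by rewrite gt t1 addr0 additive_Zp phi1 s1 mulr1.
Qed.

(** * Counting the indices *)

(** The range has 4q - 3 even numbers. The removed index lies in it unless
    q = 1 and e = 3. *)
Lemma card_shiftable (q : nat) : (0 < q)%N -> (3 * q <= b <= 3 * q + 2)%N ->
  #|[set i : 'Z_m | shiftable q i]| =
  if (q == 1) && (e == 3) then 1%N else (4 * q - 4)%N.
Proof.
move=> q_gt0 hbq; have [hb he hm] := par.
pose f (k : 'I_(4 * q - 3)) : 'Z_m := (4 * b - 4 * q + 4 + 2 * k)%:R.
have fE k : f k = (4 * b - 4 * q + 4 + 2 * k)%N :> nat.
  by rewrite val_Zm_nat //; case: k => k /=; lia.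
pose c : 'Z_m := (4 * b + 2 * (e == 3))%:R.
have cE : c = (4 * b + 2 * (e == 3))%N :> nat by rewrite val_Zm_nat //; lia.
have f_inj : injective f.
  move=> k l /(congr1 (@nat_of_ord _)); rewrite !fE => ekl.
  by apply: val_inj => /=; lia.
have fP (i : 'Z_m) : (i \in [set f k | k in 'I_(4 * q - 3)]) =
    (~~ odd i && (4 * b - 4 * q + 4 <= i <= 4 * b + 4 * q - 4)%N).
  apply/imsetP/idP => [[k _ ->]|hi].
    by rewrite fE; case: k => k /= hk; lia.
  have hk : ((i - (4 * b - 4 * q + 4)) %/ 2 < 4 * q - 3)%N by lia.
  by exists (Ordinal hk) => //; apply: val_inj; rewrite /= fE /=; lia.
have -> : [set i : 'Z_m | shiftable q i] =
    [set f k | k in 'I_(4 * q - 3)] :\ c.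
  apply/setP => i; rewrite !inE fP /shiftable -(inj_eq val_inj) /= cE.
  by rewrite andbA andbC.
have := cardsD1 c [set f k | k in 'I_(4 * q - 3)].
rewrite card_imset // card_ord fP cE; case: eqP => e3; case: eqP => q1 /=; lia.
Qed.
End Family.

Local Close Scope ring_scope.

Theorem theorem5p5 (q y z m : nat)
    (Hy : y \in [:: 0; 1; 2]) (Hz : z \in [:: 1; 3; 5; 7])
    (Hm : m = 24 * q + 8 * y + z) (Hm33 : 33 <= m) :
  let b := 3 * q + y in
  let e := (z - 1) %/ 2 in
  let F := A_seq m b e |: [set A_assoc b e i | i in I_set m q y z] in
  [/\ forall B : setseq _ m, B \in F -> is_CEDF (4 * m + 1) m 2 1 B,
      forall B C : setseq _ m, B \in F -> C \in F -> B != C ->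
        ~ CEDF_equiv B C
    & #|F| = if (q == 1) && (z == 7) then 2 else 4 * q - 3].
Proof.
move=> b e F.
have hy : (y <= 2)%N by move: Hy; rewrite !inE; lia.
have hz : (z = 2 * e + 1 /\ e <= 3)%N.
  by rewrite /e; move: Hz; rewrite !inE => /or4P[] /eqP ->.
have par : params m b e by split; rewrite /b; lia.
have hbq : (3 * q <= b <= 3 * q + 2)%N by rewrite /b; lia.
have q_gt0 : (0 < q)%N by lia.
have z7 : (z == 7) = (e == 3) by lia.
have IE : I_set m q y z = [set i : 'Z_m | shiftable b e q i].
  apply/setP => i; rewrite !inE /shiftable.
  have -> : (z %/ 7 = (e == 3))%N by rewrite -z7; lia.
  by rewrite /b; congr [&& _, _ & _]; lia.
have FP B : B \in F -> B = A_seq m b e \/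
    exists2 i, shiftable b e q (i : 'Z_m) & B = A_assoc b e i.
  rewrite in_setU1 => /orP[/eqP ->|/imsetP[i]]; first by left.
  by rewrite IE inE => hi ->; right; exists i.
have framedF B : B \in F -> framed B.
  by case/FP=> [->|[i hi ->]];
    [apply: framed_A_seq | apply: framed_A_assoc hbq hi].
split.
- move=> B /FP[->|[i hi ->]]; first exact: CEDF_A_seq.
  exact: CEDF_A_assoc hbq _ hi.
- move=> B C FB FC /eqP neBC eqBC; apply: neBC.
  exact: (framed_equiv_eq par (framedF _ FB) (framedF _ FC) eqBC).
have notinF : A_seq m b e \notin [set A_assoc b e i | i in I_set m q y z].
  apply/imsetP => -[i]; rewrite IE inE => hi eqA.
  by have := A_assoc_new par hbq hi; rewrite -eqA eqxx.
rewrite cardsU1 notinF card_in_imset.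
  by rewrite IE (card_shiftable par q_gt0 hbq) z7; case: ifP => _; lia.
move=> i j; rewrite IE !inE => hi hj eqA; apply/eqP.
have := A_assoc_new par hbq hi; apply: contraNT => ij.
by rewrite eqA A_assoc_other.
Qed.
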